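(* Let $q$ be a prime power and $G=PSL_2(q)$. Let $a\in\mathbb{F}_q$ be such that the polynomial $P_a(\lambda)=\lambda^2-a\lambda+1$ is irreducible over $\mathbb{F}_q$ and a root $\omega$ of it has order $q+1$ in $\mathbb{F}_{q^2}^*$. If $q$ is odd, let moreover $b\in\mathbb{F}_q$ be such that $u(b)\cdot s\notin [u(a)\cdot s]^{k}B$ for every $0\le k<\frac{q+1}{2}$. Then every $g\in G$ has a unique presentation in the following form. (1) If $\mathbb{F}_q$ has characteristic $2$: $g=[u(a)\cdot s]^{k}\cdot u(x)\cdot h(y)$ with $x\in\mathbb{F}_q$, $y\in\mathbb{F}_q^*$ and $0\le k\le q$ (the triple $(k,x,y)$ is unique). (2) If $\mathbb{F}_q$ has odd characteristic: $g=[u(a)\cdot s]^{k}\cdot[u(b)\cdot s\cdot u(-b)]^{\ell}\cdot u(x)\cdot h(y)$ with $x\in\mathbb{F}_q$, $y\in\mathbb{F}_q^*$, $0\le k<\frac{q+1}{2}$ and $\ell\in\{0,1\}$ (here $k,\ell,x$ and the element $h(y)$ are unique, i.e. $y$ is unique up to sign).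
   Context: $PSL_2(q)=SL_2(\mathbb{F}_q)/\{\pm I\}$. For $x\in\mathbb{F}_q$ and $y\in\mathbb{F}_q^*$, $u(x)$, $h(y)$, $s$ denote the images in $PSL_2(q)$ of the matrices $\begin{pmatrix}1&x\\0&1\end{pmatrix}$, $\begin{pmatrix}y&0\\0&y^{-1}\end{pmatrix}$, $\begin{pmatrix}0&1\\-1&0\end{pmatrix}$ respectively. $B=\{u(x)h(y): x\in\mathbb{F}_q,\ y\in\mathbb{F}_q^*\}$ is the image of the subgroup of upper triangular matrices. For $q$ odd, $h(y)=h(-y)$ in $PSL_2(q)$. *)

(* Defs.v *)
From HB Require Import structures.
From mathcomp Require Import all_boot all_order all_algebra.
From mathcomp Require Import all_fingroup all_solvable all_field.

Set Implicit Arguments.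
Unset Strict Implicit.
Unset Printing Implicit Defensive.

Import GRing.Theory.
Local Open Scope ring_scope.
Local Open Scope group_scope.

Section PSL2.
Variable F : finFieldType.

Definition SL2 : {set {'GL_2[F]}} := [set M : {'GL_2[F]} | \det (GLval M) == 1%R].

Lemma SL2_group_set : group_set SL2.
Proof.
apply/group_setP; split; first by rewrite inE det1.
move=> M N; rewrite !inE => /eqP dM /eqP dN.
by rewrite GL_MxE det_mulmx dM dN mulr1.
Qed.
Canonical SL2_group := Group SL2_group_set.

Definition pm1 : {set {'GL_2[F]}} :=
  [set M : {'GL_2[F]} | (GLval M == 1%R) || (GLval M == (- 1)%R)].

Lemma pm1_group_set : group_set pm1.
Proof.
apply/group_setP; split; first by rewrite inE eqxx.
move=> M N; rewrite !inE GL_ME.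
by move=> /orP[]/eqP-> /orP[]/eqP->; rewrite ?mulrNN ?mulr1 ?mul1r eqxx ?orbT.
Qed.
Canonical pm1_group := Group pm1_group_set.

(* [A / H] and [coset H] restrict to the normaliser of H; by this lemma they
   are here the ordinary quotient group and the ordinary projection. *)
Lemma pm1_normal : pm1 <| SL2.
Proof.
apply/andP; split.
  apply/subsetP=> M; rewrite !inE => /orP[]/eqP->; first by rewrite det1.
  by rewrite -scaleN1r detZ det1 mulr1 sqrrN expr1n.
apply: subset_trans (cent_sub _); apply/centsP=> M _ N.
rewrite inE => /orP[]/eqP eN; apply: (val_inj : injective (@GLval 2 F));
  rewrite !GL_ME eN.
  by rewrite mul1r mulr1.
by rewrite mulN1r mulrN1.
Qed.

Definition PSL2 : {set coset_of pm1} := SL2 / pm1.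

Definition mx22 (a b c d : F) : 'M[F]_2 :=
  \matrix_(i, j) if i == 0%R then (if j == 0%R then a else b)
                 else (if j == 0%R then c else d).

Lemma det_mx22 a b c d : \det (mx22 a b c d) = (a * d - b * c)%R.
Proof.
rewrite (expand_det_row _ ord0) !big_ord_recl big_ord0 addr0.
rewrite /cofactor !det_mx11 !mxE /= expr0 expr1 !mul1r.
by rewrite mulN1r mulrN.
Qed.

Lemma det1_unit (M : 'M[F]_2) : \det M = 1%R -> M \is a GRing.unit.
Proof. by move=> dM; rewrite -[_ \is a _]/(M \in unitmx) unitmxE dM unitr1. Qed.

Definition SLmx (M : 'M[F]_2) (dM : \det M = 1%R) : {'GL_2[F]} :=
  FinRing.unit _ (det1_unit dM).

Lemma det_u x : \det (mx22 1 x 0 1)%R = 1%R.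
Proof. by rewrite det_mx22 mulr0 subr0 mulr1. Qed.

Lemma det_h (y : {unit F}) : \det (mx22 (val y) 0 0 (val y)^-1)%R = 1%R.
Proof. by rewrite det_mx22 mulr0 subr0 divrr ?(valP y). Qed.

Lemma det_s : \det (mx22 0 1 (- 1) 0)%R = 1%R.
Proof. by rewrite det_mx22 mulr0 mul1r sub0r opprK. Qed.

Definition u (x : F) : coset_of pm1 := coset pm1 (SLmx (det_u x)).
Definition h (y : {unit F}) : coset_of pm1 := coset pm1 (SLmx (det_h y)).
Definition s : coset_of pm1 := coset pm1 (SLmx det_s).

Definition Borel : {set coset_of pm1} := [set u x * h y | x : F, y : {unit F}].

Definition P_ (a : F) : {poly F} := ('X^2 - a *: 'X + 1)%R.

End PSL2.

Arguments s {F}.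

(* Main.v *)
(* PSL2(F) acts on the projective line of q + 1 points, and two elements that
   agree at infinity lie in the same left coset of B; hence q + 1 elements that
   are pairwise incongruent modulo B already represent all cosets.  A power of
   u(a)s with a conjugate in B has an eigenvector over F; being a combination
   c A + d of the matrix A of u(a)s, whose characteristic polynomial is
   irreducible, it is scalar, hence trivial in PSL2(F).  As (u(a)s)^k = 1 iff
   omega^(2k) = 1, the order of u(a)s is q + 1 in characteristic 2 and
   (q + 1) / 2 otherwise, so the powers of u(a)s give q + 1 cosets in the first
   case; in the second they give half of them, and the other half is obtained
   by right multiplication with u(b)su(-b). *)
Require Import Defs.
From mathcomp Require Import all_boot all_order all_algebra.
From mathcomp Require Import all_fingroup all_solvable all_field.
From mathcomp Require Import ring.
Set Implicit Arguments.
Unset Strict Implicit.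
Unset Printing Implicit Defensive.
Import GRing.Theory.
Local Open Scope group_scope.

(** * Matrix calculus in [SL2] and its image in [PSL2] *)

Section Matrices.
Variable F : finFieldType.
Implicit Types (M N : {'GL_2[F]}) (x : F) (y : {unit F}).

Lemma mx22_eta (A : 'M[F]_2) :
  A = mx22 (A ord0 ord0) (A ord0 ord_max) (A ord_max ord0) (A ord_max ord_max).
Proof.
apply/matrixP=> i j; rewrite mxE.
by case: i => [[|[|?]] ?] //; case: j => [[|[|?]] ?] //=; congr (A _ _); apply: val_inj.
Qed.

Lemma mx22_inj (a b c d a' b' c' d' : F) :
  mx22 a b c d = mx22 a' b' c' d' -> [/\ a = a', b = b', c = c' & d = d'].
Proof.
move=> /matrixP e; split; [have := e ord0 ord0 | have := e ord0 ord_max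
  | have := e ord_max ord0 | have := e ord_max ord_max]; by rewrite !mxE.
Qed.

Lemma mx22M (a b c d a' b' c' d' : F) :
  (mx22 a b c d * mx22 a' b' c' d' =
   mx22 (a * a' + b * c') (a * b' + b * d') (c * a' + d * c') (c * b' + d * d'))%R.
Proof.
apply/matrixP=> i j; rewrite !mxE !big_ord_recl big_ord0 !mxE /= addr0.
by case: i => [[|[|?]] ?] //; case: j => [[|[|?]] ?].
Qed.

Lemma mx22N (a b c d : F) : (- mx22 a b c d = mx22 (- a) (- b) (- c) (- d))%R.
Proof.
apply/matrixP=> i j; rewrite !mxE.
by case: i => [[|[|?]] ?] //; case: j => [[|[|?]] ?].
Qed.

Lemma SLmx_SL2 (A : 'M[F]_2) (dA : (\det A = 1)%R) : SLmx dA \in SL2 F.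
Proof. by rewrite inE; apply/eqP. Qed.

Lemma SL2_1 : 1 \in SL2 F.
Proof. by rewrite inE det1. Qed.

Lemma SL2_M M N : M \in SL2 F -> N \in SL2 F -> M * N \in SL2 F.
Proof.
by rewrite !inE GL_ME det_mulmx => /eqP-> /eqP->; rewrite mulr1.
Qed.

Lemma SL2_V M : M \in SL2 F -> M^-1 \in SL2 F.
Proof. by rewrite !inE GL_VE det_inv => /eqP->; rewrite invr1. Qed.

Lemma SL2_X M k : M \in SL2 F -> M ^+ k \in SL2 F.
Proof. by move=> SM; elim: k => [|k IHk]; rewrite ?SL2_1 // expgS SL2_M. Qed.

Lemma SL2_norm M : M \in SL2 F -> M \in 'N(pm1 F).
Proof. exact: (subsetP (normal_norm (pm1_normal F))). Qed.

Lemma coset_SL2M M N : M \in SL2 F -> N \in SL2 F ->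
  coset (pm1 F) M * coset (pm1 F) N = coset (pm1 F) (M * N).
Proof. by move=> /SL2_norm nM /SL2_norm nN; exact (esym (coset_morphM nM nN)). Qed.

Lemma coset_SL2V M : M \in SL2 F ->
  (coset (pm1 F) M)^-1 = coset (pm1 F) M^-1.
Proof.
move=> SM; apply: (mulgI (coset (pm1 F) M)).
by rewrite mulgV coset_SL2M ?SL2_V // mulgV coset_id ?group1.
Qed.

Lemma coset_SL2X M k : M \in SL2 F ->
  (coset (pm1 F) M) ^+ k = coset (pm1 F) (M ^+ k).
Proof.
move=> SM; elim: k => [|k IHk]; first by rewrite !expg0 coset_id ?group1.
by rewrite !expgS IHk coset_SL2M ?SL2_X.
Qed.

Lemma coset_SL2_eq M N : M \in SL2 F -> N \in SL2 F ->
  coset (pm1 F) M = coset (pm1 F) N <->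
  (GLval M = GLval N \/ GLval M = - GLval N)%R.
Proof.
move=> SM SN; split.
  case/(kercoset_rcoset (SL2_norm SM) (SL2_norm SN)) => z.
  rewrite inE => /orP[]/eqP ez ->; rewrite GL_ME ez.
    by left; rewrite mul1r.
  by right; rewrite mulN1r.
move=> eMN; rewrite -[M](mulgKV N) -coset_SL2M ?SL2_M ?SL2_V //.
rewrite coset_id ?mul1g // inE GL_ME.
have NV : (GLval N * GLval N^-1 = 1)%R by rewrite -GL_ME mulgV.
by case: eMN => ->; rewrite ?mulNr NV eqxx ?orbT.
Qed.

Lemma PSL2P g : reflect (exists2 M, M \in SL2 F & g = coset (pm1 F) M) (g \in PSL2 F).
Proof.
apply: (iffP idP); first by case/morphimP=> M nM SM ->; exists M.
case=> M SM ->; exact: mem_quotient.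
Qed.

(** The chosen representative differs from a matrix of determinant one by an element of [pm1], and
    [pm1] lies in [SL2]. *)
Lemma repr_SL2 g : g \in PSL2 F -> repr (g : coset_of (pm1 F)) \in SL2 F.
Proof.
case/PSL2P=> M SM eg; have /kercoset_rcoset : repr g \in 'N(pm1 F) by exact: repr_coset_norm.
move/(_ M (SL2_norm SM)); rewrite -eg coset_reprK => /(_ erefl) [z zP ->].
by rewrite SL2_M // (subsetP (normal_sub (pm1_normal F))).
Qed.

Lemma det_SL2 M : M \in SL2 F ->
  (GLval M ord0 ord0 * GLval M ord_max ord_max
   - GLval M ord0 ord_max * GLval M ord_max ord0 = 1)%R.
Proof. by rewrite inE [GLval M]mx22_eta det_mx22 !mxE /= => /eqP. Qed.

Lemma u_PSL2 x : u x \in PSL2 F.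
Proof. by apply/PSL2P; exists (SLmx (det_u x)); rewrite ?SLmx_SL2. Qed.

Lemma h_PSL2 y : h y \in PSL2 F.
Proof. by apply/PSL2P; exists (SLmx (det_h y)); rewrite ?SLmx_SL2. Qed.

Lemma s_PSL2 : @s F \in PSL2 F.
Proof. by apply/PSL2P; exists (SLmx (det_s F)); rewrite ?SLmx_SL2. Qed.

(** * The Borel subgroup and its left cosets *)

Lemma uh_coset x y :
  u x * h y = coset (pm1 F) (SLmx (det_u x) * SLmx (det_h y)).
Proof. by rewrite coset_SL2M ?SLmx_SL2. Qed.

Lemma uh_mx x y : (GLval (SLmx (det_u x) * SLmx (det_h y))%g =
  mx22 (val y) (x * (val y)^-1) 0 (val y)^-1 :> 'M[F]_2)%R.
Proof. by rewrite GL_ME mx22M !(mul0r, mulr0, mul1r, add0r, addr0). Qed.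

(** Matrices with the same class agree up to sign, so the vanishing of the lower left entry depends
    on the class alone. *)
Lemma Borel_coset M : M \in SL2 F ->
  (coset (pm1 F) M \in Borel F) = (GLval M ord_max ord0 == 0)%R.
Proof.
move=> SM; apply/idP/eqP.
  case/imset2P=> x y _ _; rewrite uh_coset.
  move/coset_SL2_eq => /(_ SM); rewrite SL2_M ?SLmx_SL2 // uh_mx => /(_ isT).
  by case=> ->; rewrite !mxE /= ?oppr0.
move=> M10; have := det_SL2 SM; rewrite M10 mulr0 subr0 => dM.
have uM : GLval M ord0 ord0 \is a GRing.unit.
  by rewrite unitfE; apply: contra_eqN dM => /eqP->; rewrite mul0r eq_sym oner_eq0.
have M11 : GLval M ord_max ord_max = (GLval M ord0 ord0)^-1%R.
  by apply: (mulrI uM); rewrite dM divrr.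
(* The upper right entry of the product is [x * (val y)^-1]; with the upper left entry as [y], this
   forces [x] to be the product of both upper entries. *)
apply/imset2P; exists (GLval M ord0 ord_max * GLval M ord0 ord0)%R (FinRing.unit F uM) => //.
rewrite uh_coset; apply/coset_SL2_eq => //; first by rewrite SL2_M ?SLmx_SL2.
left; rewrite uh_mx [LHS]mx22_eta /= M10 M11; congr mx22.
by rewrite mulrK.
Qed.

(** A change of sign negates both [val y] and [x * (val y)^-1], and so leaves [x] fixed. *)
Lemma uh_inj x y x' y' : u x * h y = u x' * h y' ->
  x = x' /\ (val y = val y' \/ val y = - val y')%R.
Proof.
have y0 : val y \is a GRing.unit by exact: valP.
have y0' : val y' \is a GRing.unit by exact: valP.
rewrite !uh_coset => /coset_SL2_eq; rewrite !SL2_M ?SLmx_SL2 // !uh_mx => /(_ isT isT).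
rewrite mx22N; case=> /mx22_inj[e1 e2 _ _]; rewrite e1 ?invrN ?mulrN in e2.
  by split; [apply: (mulIr _ e2); rewrite unitrV | left].
by split; [apply: (mulIr _ (oppr_inj e2)); rewrite unitrV | right].
Qed.

Lemma Borel_sub : Borel F \subset PSL2 F.
Proof. by apply/subsetP=> _ /imset2P[x y _ _ ->]; rewrite groupM ?u_PSL2 ?h_PSL2. Qed.

Lemma Borel_group_set : group_set (Borel F).
Proof.
apply/group_setP; split.
  by rewrite -(coset_id (group1 (pm1 F))) Borel_coset ?SL2_1 // !mxE.
move=> g g' Bg Bg'; have /PSL2P[M SM eM] := subsetP Borel_sub g Bg.
have /PSL2P[N SN eN] := subsetP Borel_sub g' Bg'.
move: Bg Bg'; rewrite eM eN coset_SL2M // !Borel_coset ?SL2_M // GL_ME.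
move=> /eqP M0 /eqP N0.
by rewrite [GLval M]mx22_eta [GLval N]mx22_eta mx22M mxE /= M0 N0 mul0r mulr0 addr0.
Qed.
Canonical Borel_group := Group Borel_group_set.

(** The right-hand side is the determinant formed by the first columns of [M] and [N]; it vanishes
    exactly when both matrices send infinity to the same point. *)
Lemma SL2_col M N : M \in SL2 F ->
  (GLval (M^-1 * N)%g ord_max ord0 =
   GLval M ord0 ord0 * GLval N ord_max ord0 - GLval M ord_max ord0 * GLval N ord0 ord0)%R.
Proof.
move=> SM; have dM := det_SL2 SM; move eX: (M^-1 * N) => X.
have : GLval N = (GLval M * GLval X)%R by rewrite -GL_ME -eX mulKVg.
rewrite {1}[GLval N]mx22_eta {1}[GLval M]mx22_eta {1}[GLval X]mx22_eta mx22M.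
by case/mx22_inj=> e1 _ e2 _; rewrite e1 e2 -[LHS]mul1r -dM; ring.
Qed.

(* The image of infinity (encoded as [None]) under the Moebius transformation
   of [g]; it separates the left cosets of the Borel subgroup. *)
Definition at_infinity (g : coset_of (pm1 F)) : option F :=
  let M := GLval (repr g) in
  if M ord_max ord0 == 0%R then None else Some (M ord0 ord0 / M ord_max ord0)%R.

Lemma at_infinity_inj g g' : g \in PSL2 F -> g' \in PSL2 F ->
  at_infinity g = at_infinity g' -> g^-1 * g' \in Borel F.
Proof.
move=> Gg Gg'; have SM := repr_SL2 Gg; have SN := repr_SL2 Gg'.
have [eg eg'] := (coset_reprK g, coset_reprK g').
rewrite /at_infinity; move: SM SN eg eg'.
move: (repr g) (repr g') => M N SM SN <- <- e.
rewrite coset_SL2V // coset_SL2M ?SL2_V // Borel_coset ?SL2_M ?SL2_V // SL2_col //.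
move: e; case: eqP => [->|/eqP M0]; case: eqP => [->|/eqP N0] //.
  by rewrite mul0r mulr0 subr0.
by case=> e; rewrite -[X in (X * _)%R](divfK M0) e -!mulrA; apply/eqP; field.
Qed.

(** Incongruent elements have distinct images of infinity. As there are as many of them as points on
    the projective line, every point is hit, in particular the image of infinity under [g]. *)
Lemma coset_transversal (I : finType) (e : I -> coset_of (pm1 F)) :
    #|I| = #|F|.+1 -> (forall i, e i \in PSL2 F) ->
    (forall i j, (e i)^-1 * e j \in Borel F -> i = j) ->
  forall g, g \in PSL2 F -> exists i x y, g = e i * u x * h y.
Proof.
move=> cI eG einj g Gg.
have inj : injective (at_infinity \o e).
  by move=> i j /(at_infinity_inj (eG i) (eG j)); apply: einj.
have /codomP[i /= ei] := inj_card_onto inj (eq_leq (etrans (card_option F) (esym cI))) (at_infinity g).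
have /imset2P[x y _ _ exy] := at_infinity_inj (eG i) Gg (esym ei).
by exists i, x, y; rewrite -mulgA -exy mulKVg.
Qed.

Lemma coset_transversal_uniq (I : finType) (e : I -> coset_of (pm1 F)) i j x y x' y' :
    (forall i j, (e i)^-1 * e j \in Borel F -> i = j) ->
    e i * u x * h y = e j * u x' * h y' -> i = j /\ u x * h y = u x' * h y'.
Proof.
move=> einj; rewrite -!mulgA => exy.
have eij : i = j.
  have -> := einj i j => //.
  have -> : (e i)^-1 * e j = (u x * h y) * (u x' * h y')^-1.
    by apply: (mulgI (e i)); rewrite mulKVg [RHS]mulgA exy mulgK.
  by rewrite groupM ?groupV //; apply: imset2_f.
by split=> //; move: exy; rewrite eij => /mulgI.
Qed.

End Matrices.

(** * Powers of [u a * s] and powers of [omega] *)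

Section Torus.
Variables (F : finFieldType) (a : F).
Hypothesis ha : irreducible_poly (P_ a).

(** A root in [F] would split off a linear factor from a polynomial of degree 2. *)
Lemma P_neq0 (x : F) : (x ^+ 2 - a * x + 1 != 0)%R.
Proof.
apply/eqP=> Px; have [_ irrP] := ha.
have : ('X - x%:P %| P_ a)%R.
  by rewrite dvdp_XsubCl rootE /P_ !hornerE Px.
move/irrP; rewrite size_XsubC => /(_ isT) /eqp_size; rewrite size_XsubC /P_.
rewrite -addrA size_polyDl ?size_polyXn // ltnS.
rewrite (leq_trans (size_polyD _ _)) // geq_max size_poly1 andbT size_polyN.
by rewrite (leq_trans (size_scale_leq _ _)) // size_polyX.
Qed.

(** The lift of [u a * s] with rows (-a, 1) and (-1, 0); its trace is -a, so its eigenvalues are the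
    negatives of the roots of [P_ a]. *)
Definition torus_gen : {'GL_2[F]} := SLmx (det_u a) * SLmx (det_s F).

Lemma torus_gen_SL2 : torus_gen \in SL2 F.
Proof. by rewrite SL2_M ?SLmx_SL2. Qed.

Lemma torus_coset : u a * s = coset (pm1 F) torus_gen.
Proof. by rewrite -coset_SL2M ?SLmx_SL2. Qed.

Lemma torus_cosetX k : (u a * s) ^+ k = coset (pm1 F) (torus_gen ^+ k).
Proof. by rewrite torus_coset coset_SL2X ?torus_gen_SL2. Qed.

Lemma torus_PSL2 k : (u a * s) ^+ k \in PSL2 F.
Proof. by rewrite groupX // groupM ?u_PSL2 ?s_PSL2. Qed.

Lemma scalar_coset M (d : F) : M \in SL2 F ->
  GLval M = mx22 d 0%R 0%R d -> coset (pm1 F) M = 1.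
Proof.
move=> SM eM; apply: coset_id; rewrite inE eM.
have := det_SL2 SM; rewrite eM !mxE /= mulr0 subr0 => /eqP.
rewrite -expr2 sqrf_eq1 => /orP[]/eqP->; apply/orP; [left | right];
  by rewrite [X in _ == X]mx22_eta !mxE /= ?oppr0.
Qed.

Variables (L : fieldExtType F) (omega : L).
Hypothesis romega : root (map_poly (GRing.in_alg L) (P_ a)) omega.

Lemma omega_sqr : (omega ^+ 2 = GRing.in_alg L a * omega - 1)%R.
Proof.
move: romega; rewrite rootE /P_ rmorphD rmorphB /= map_polyXn map_polyZ map_polyX rmorph1.
rewrite !hornerE => /eqP e.
by rewrite -[LHS]subr0 -e /=; ring.
Qed.

Lemma omega_notin_base (x : F) : omega != GRing.in_alg L x.
Proof.
apply/eqP=> ex; have := omega_sqr; rewrite ex -rmorphXn -rmorphM -(rmorph1 (GRing.in_alg L)) -rmorphB.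
move/fmorph_inj => /eqP; rewrite -subr_eq0 => /eqP e.
by have /eqP[] := P_neq0 x; rewrite -e; ring.
Qed.

(* The matrix [A] of [torus_gen] and [- omega] both annihilate
   'X^2 + a 'X + 1, so [A ^+ k] and [(- omega) ^+ k] have the same coordinates
   in the bases [A, 1] and [- omega, 1]. *)
Lemma torus_powE k : exists c d : F,
  GLval (torus_gen ^+ k) = mx22 (d - c * a)%R c (- c)%R d /\
  ((- omega) ^+ k = GRing.in_alg L c * - omega + GRing.in_alg L d)%R.
Proof.
elim: k => [|k [c [d [eA eo]]]].
  exists 0%R, 1%R; split; last by rewrite expr0 rmorph0 rmorph1 mul0r add0r.
  by rewrite expg0 [LHS]mx22_eta !mxE /= mul0r subr0 oppr0.
exists (d - c * a)%R, (- c)%R; split.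
  rewrite expgS GL_ME eA GL_ME /= !mx22M; congr mx22; ring.
rewrite exprS eo mulrDr mulrCA mulrNN -expr2 omega_sqr.
by rewrite rmorphB rmorphM rmorphN /=; ring.
Qed.

(** If the conjugate by [M] is upper triangular, the first column (p, r) of [M] is an eigenvector of
    the k-th power, which must then be scalar. *)
Lemma torus_conj_Borel k t : t \in PSL2 F ->
  (u a * s) ^+ k ^ t \in Borel F -> (u a * s) ^+ k = 1.
Proof.
case/PSL2P=> M SM ->; have [c [d [eA _]]] := torus_powE k.
have SA := SL2_X k torus_gen_SL2.
rewrite torus_cosetX conjgE coset_SL2V // !coset_SL2M ?SL2_M ?SL2_V //.
rewrite Borel_coset ?SL2_M ?SL2_V // SL2_col // GL_ME eA {2 4}[GLval M]mx22_eta mx22M !mxE /=.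
set p : F := GLval M ord0 ord0; set r : F := GLval M ord_max ord0.
(* The second factor is [P_ a] made homogeneous. It has no zero other than (0, 0), and a column of
   an invertible matrix is not zero. *)
have -> : (p * (- c * p + d * r) - r * ((d - c * a) * p + c * r) =
  - c * (p ^+ 2 - a * p * r + r ^+ 2))%R by ring.
rewrite mulf_eq0 oppr_eq0 => /orP[/eqP c0 | /eqP pr0].
  by apply: (@scalar_coset _ d) => //; rewrite eA c0 mul0r subr0 oppr0.
have [r0|r0] := eqVneq r 0%R.
  move: pr0; rewrite r0 mulr0 expr0n addr0 subr0 => /eqP; rewrite sqrf_eq0 => /eqP p0.
  have := det_SL2 SM; rewrite -/p -/r p0 r0 mul0r mulr0 subr0 => /eqP.
  by rewrite eq_sym oner_eq0.
have /eqP[] := P_neq0 (p / r)%R.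
have -> : ((p / r) ^+ 2 - a * (p / r) + 1 = (p ^+ 2 - a * p * r + r ^+ 2) / r ^+ 2)%R by field.
by rewrite pr0 mul0r.
Qed.

(** Being trivial in [PSL2] means that the matrix power is 1 or -1. By the common coordinates this
    says the same of [(- omega) ^+ k], and squaring removes the sign. *)
Lemma torus_pow_eq1 k : (u a * s) ^+ k = 1 <-> (omega ^+ (2 * k) = 1)%R.
Proof.
have [c [d [eA eo]]] := torus_powE k.
have SA := SL2_X k torus_gen_SL2.
have -> : (omega ^+ (2 * k) = ((- omega) ^+ k) ^+ 2)%R by rewrite exprM -sqrrN -!exprM mulnC.
split.
  rewrite torus_cosetX -(coset_id (group1 (pm1 F))).
  move/(coset_SL2_eq SA (SL2_1 F)); rewrite eA [GLval 1]mx22_eta !mxE /= mx22N.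
  rewrite eo; case=> /mx22_inj[_ -> _ ->];
    by rewrite ?rmorphN rmorph0 rmorph1 ?oppr0 mul0r add0r ?sqrrN expr1n.
move=> e; have c0 : c = 0%R.
  apply/eqP/negPn/negP=> c0.
  have [x ex] : exists x, ((- omega) ^+ k = GRing.in_alg L x)%R.
    move/eqP: e; rewrite sqrf_eq1 => /orP[]/eqP->; [exists 1%R | exists (-1)%R];
    by rewrite ?rmorphN rmorph1.
  (* This is [omega] obtained by solving x = - c omega + d. *)
  have /eqP[] := omega_notin_base ((d - x) / c)%R.
  rewrite rmorphM fmorphV rmorphB /= -[x%:A%R]ex eo !in_algE.
  have {}c0 : c%:A%R != 0%R :> L by rewrite -in_algE fmorph_eq0.
  by field.
by rewrite torus_cosetX; apply: (@scalar_coset _ d) => //; rewrite eA c0 mul0r subr0 oppr0.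
Qed.

(** * The order of [u a * s] and the incongruence of its powers *)

Hypothesis oomega : (#|F|.+1).-primitive_root%R omega.

Lemma dvd_order_torus k : (#[u a * s] %| k)%N = (#|F|.+1 %| 2 * k)%N.
Proof.
by rewrite order_dvdn (prim_order_dvd oomega); apply/eqP/eqP => /torus_pow_eq1.
Qed.

Lemma odd_card_finField : odd #|F| = (2 \notin [pchar F]%R).
Proof.
have [p p_pr pF] := finPcharP F; have [n cF] : exists n, #|F| = (p ^ n)%N.
  have /abelem_pgroup/p_natP := fin_ring_pchar_abelem pF.
  by rewrite cardsT; case=> n; exists n.
have n0 : n != 0%N by apply: contraL (finRing_gt1 F) => /eqP n0; rewrite cF n0.
rewrite cF oddX (negPf n0) /= (pcharf_eq pF).
by rewrite !inE; case: (even_prime p_pr) => [->|op] //; rewrite op; case: eqP op => // <-.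
Qed.

Lemma order_torus_even : 2 \in [pchar F]%R -> #[u a * s] = #|F|.+1.
Proof.
move=> F2; apply/eqP; rewrite eqn_dvd dvd_order_torus dvdn_mull //=.
(* Here q + 1 is odd, so the factor 2 can be cancelled. *)
have := dvdnn #[u a * s]; rewrite dvd_order_torus Gauss_dvdr //.
by rewrite coprimen2 /= odd_card_finField F2.
Qed.

Lemma order_torus_odd : 2 \notin [pchar F]%R -> #[u a * s] = (#|F|.+1 %/ 2)%N.
Proof.
move=> F2; have e : #|F|.+1 = (2 * (#|F|.+1 %/ 2))%N.
  by rewrite mulnC divnK // dvdn2 /= odd_card_finField F2.
apply/eqP; rewrite eqn_dvd dvd_order_torus -e dvdnn /=.
by rewrite -(@dvdn_pmul2l 2) // -e -dvd_order_torus.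
Qed.

(** The quotient of two powers is again a power, hence trivial once a conjugate of it lies in the
    Borel subgroup. Both [t] = 1 and [t] = u(b)su(-b) are needed later. *)
Lemma torus_conj_Borel_inj i j t : t \in PSL2 F ->
  i < #[u a * s] -> j < #[u a * s] ->
  ((u a * s) ^- i * (u a * s) ^+ j) ^ t \in Borel F -> i = j.
Proof.
move=> Gt lti ltj.
have /cycleP[m em] : (u a * s) ^- i * (u a * s) ^+ j \in <[u a * s]>.
  by rewrite groupM ?groupV ?mem_cycle.
rewrite em => /(torus_conj_Borel Gt); rewrite -em => /eqP.
by rewrite -eq_mulVg1 eq_expg_mod_order !modn_small // => /eqP.
Qed.

Lemma torus_mul_notin_Borel (b : F) z :
  (forall k, k < #[u a * s] -> u b * s \notin (u a * s) ^+ k *: Borel F) ->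
  z \in <[u a * s]> -> z * (u b * s * u (- b)%R) \notin Borel F.
Proof.
move=> hb; rewrite -groupV => /cyclePmin[k ltk ez].
apply: contra (hb k ltk); rewrite mem_lcoset -ez invgK => Bz.
have Bu : u (- b)%R \in Borel F by rewrite Borel_coset ?SLmx_SL2 // mxE.
by rewrite -[_ * _](mulgK (u (- b)%R)) -(mulgA z) groupM ?groupV.
Qed.

End Torus.

(** * The normal forms in even and odd characteristic *)

Theorem theorem2p4 (F : finFieldType) (q : nat) (hq : #|F| = q)
    (a : F) (ha : irreducible_poly (P_ a))
    (L : fieldExtType F) (hL : \dim {:L}%VS = 2) (omega : L)
    (romega : root (map_poly (GRing.in_alg L) (P_ a)) omega)
    (oomega : (q.+1).-primitive_root%R omega) :
  (2 \in [pchar F]%R ->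
     forall g, g \in PSL2 F ->
     exists (k : nat) (x : F) (y : {unit F}),
       [/\ k <= q,
           g = (u a * s) ^+ k * u x * h y
         & forall (k' : nat) (x' : F) (y' : {unit F}),
             k' <= q -> g = (u a * s) ^+ k' * u x' * h y' ->
             [/\ k' = k, x' = x & y' = y]])
  /\
  (2 \notin [pchar F]%R ->
     forall b : F,
     (forall k : nat, k < q.+1 %/ 2 ->
        u b * s \notin (u a * s) ^+ k *: Borel F) ->
     forall g, g \in PSL2 F ->
     exists (k l : nat) (x : F) (y : {unit F}),
       [/\ k < q.+1 %/ 2, l \in [:: 0; 1]%N,
           g = (u a * s) ^+ k * (u b * s * u (- b)%R) ^+ l * u x * h y
         & forall (k' l' : nat) (x' : F) (y' : {unit F}),
             k' < q.+1 %/ 2 -> l' \in [:: 0; 1]%N ->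
             g = (u a * s) ^+ k' * (u b * s * u (- b)%R) ^+ l' * u x' * h y' ->
             [/\ k' = k, l' = l, x' = x, h y' = h y
               & val y' = val y \/ val y' = (- val y)%R]]).
Proof.
have omF : (#|F|.+1).-primitive_root%R omega by rewrite hq.
split=> [F2 | F2 b hb] g Gg.
  have og : #[u a * s] = q.+1 by rewrite (order_torus_even ha romega omF F2) hq.
  pose e (i : 'I_q.+1) := (u a * s) ^+ i.
  have einj i j : (e i)^-1 * e j \in Borel F -> i = j.
    rewrite -[X in X \in _]conjg1 => Be; apply: val_inj.
    by apply: (torus_conj_Borel_inj ha romega (group1 _) _ _ Be); rewrite og.
  have cI : #|'I_q.+1| = #|F|.+1 by rewrite card_ord hq.
  have [k [x [y eg]]] := coset_transversal cI (fun i => torus_PSL2 a i) einj Gg.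
  exists k, x, y; split=> // [|k' x' y']; first by rewrite -ltnS.
  rewrite -ltnS => ltk'; rewrite eg => eg'.
  have [ek /uh_inj[ex ey]] :=
    @coset_transversal_uniq _ _ e k (Ordinal ltk') _ _ _ _ einj eg'.
  split; [by rewrite ek | by [] | apply: val_inj].
  (* In characteristic 2 the ambiguity of sign disappears. *)
  by case: ey => // ->; rewrite oppr_pchar2.
have og : #[u a * s] = (q.+1 %/ 2)%N by rewrite (order_torus_odd ha romega omF F2) hq.
rewrite -og in hb *; move er: (u b * s * u (- b)%R) => r.
have Gr : r \in PSL2 F by rewrite -er !groupM ?u_PSL2 ?s_PSL2.
have nBr i j : (u a * s) ^- i * (u a * s) ^+ j * r \notin Borel F.
  by rewrite -er; apply: torus_mul_notin_Borel hb _; rewrite groupM ?groupV ?mem_cycle.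
pose e (i : 'I_#[u a * s] * bool) := (u a * s) ^+ i.1 * r ^+ i.2.
have einj i j : (e i)^-1 * e j \in Borel F -> i = j.
  (* With equal second components, the quotient is a power of [u a * s] conjugated by [r] or by 1.
     With different ones it contradicts [nBr], after inversion if [r] stands on the left. *)
  case: i j => [i [|]] [j [|]]; rewrite /e /= ?expg0 ?expg1 ?mulg1 ?invMg ?mulgA.
  - move=> Be; congr (_, _); apply: val_inj.
    apply: (torus_conj_Borel_inj ha romega Gr) => //=.
    by rewrite conjgE !mulgA.
  - move=> Be; case/negP: (nBr j i).
    by rewrite -groupV !invMg invgK mulgA.
  - by move=> Be; case/negP: (nBr i j).
  - rewrite -[X in X \in _]conjg1 => Be; congr (_, _); apply: val_inj.
    exact: (torus_conj_Borel_inj ha romega (group1 _) _ _ Be).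
have cI : #|{: 'I_#[u a * s] * bool}| = #|F|.+1.
  (* As q is odd, twice (q + 1) / 2 is exactly q + 1. *)
  by rewrite card_prod card_ord card_bool og -hq divnK // dvdn2 /= odd_card_finField F2.
have eG i : e i \in PSL2 F by rewrite groupM ?torus_PSL2 ?groupX.
have [[k l] [x [y eg]]] := coset_transversal cI eG einj Gg.
exists k, l, x, y; split=> // [|k' l' x' y' ltk' l'01]; first by case: l {eg}.
have [l0 -> {l'01}] : exists l0 : bool, l' = l0.
  by move: l'01; rewrite !inE => /orP[]/eqP->; [exists false | exists true].
rewrite eg => eg'.
have [[ek el] euh] :=
  @coset_transversal_uniq _ _ e (k, l) (Ordinal ltk', l0) _ _ _ _ einj eg'.
have [ex ey] := uh_inj euh.
split; rewrite ?ek ?el //; first by apply: (mulgI (u x)); rewrite euh ex.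
by case: ey => ->; [left | right; rewrite opprK].
Qed.
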